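(* Let $l_1=2\,\mathrm{arccosh}\big(2\cos\frac{\pi}{4}\cos\frac{\pi}{3}+\cos\frac{\pi}{4}\big)$ and $l_3=2\,\mathrm{arccosh}\big(2\cos^2\frac{\pi}{4}+\cos\frac{\pi}{3}\big)$. In the length spectrum of the triangle group $\Gamma(3,4,4)$, the smallest length is $l_1$, it occurs with multiplicity at least $2$, and the second smallest distinct length is $l_3$ (so $l_1<l_3$, $l_3$ is in the spectrum, and no element of the spectrum lies strictly between $l_1$ and $l_3$).
   Context: Let $\mathbf H$ be the hyperbolic plane with its distance $d$. Let $T$ be a hyperbolic triangle with angles $\pi/3,\pi/4,\pi/4$; the triangle group $\Gamma(3,4,4)$ is the group of orientation-preserving elements of the group generated by the reflections in the sides of $T$. For a hyperbolic element $\gamma$ its length is $l(\gamma)=\inf\{d(x,\gamma x): x\in\mathbf H\}$. The length spectrum is the family of the numbers $l(\gamma)$ as $\gamma$ runs over the $\Gamma(3,4,4)$-conjugacy classes of hyperbolic elements of $\Gamma(3,4,4)$, and the multiplicity of a length is the number of such conjugacy classes having that length. *)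

(* Defs.v *)
From HB Require Import structures.
From mathcomp Require Import all_boot all_order all_algebra.
From mathcomp Require Import all_classical all_reals all_analysis.

Set Implicit Arguments.
Unset Strict Implicit.
Unset Printing Implicit Defensive.

Import Order.TTheory GRing.Theory Num.Theory.
Import numFieldNormedType.Exports.
Local Open Scope classical_set_scope.
Local Open Scope ring_scope.

(* The hyperbolic plane is the hyperboloid model: the upper sheet of
   <p, p> = -1 for the form <p, q> = p_0 q_0 + p_1 q_1 - p_2 q_2 on R^3.
   Its isometries are the restrictions of the matrices of O^+(2, 1); since the
   sheet spans R^3, such a matrix is determined by the isometry it induces. *)
Section HyperbolicPlane.
Variable R : realType.
Implicit Types (p q r n : 'cV[R]_3) (g h : 'M[R]_3).

(* Meant for 1 <= x, where it is the inverse of cosh on [0, +oo). *)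
Definition arccosh (x : R) : R := ln (x + Num.sqrt (x ^+ 2 - 1)).

Definition lorentz_mx : 'M[R]_3 :=
  diag_mx (\row_i (if i == ord_max then -1 else 1)).

Definition lorentz p q : R := (p^T *m lorentz_mx *m q) 0 0.

Definition hyp_plane : set 'cV[R]_3 :=
  [set p | lorentz p p = -1 /\ 0 < p ord_max 0].

Definition hyp_dist p q : R := arccosh (- lorentz p q).

(* Geodesics are the intersections of the sheet with linear planes, so three
   points lie on a geodesic iff they have a common nonzero normal. *)
Definition hyp_triangle p q r : Prop :=
  [/\ hyp_plane p, hyp_plane q, hyp_plane r &
      forall n, lorentz n p = 0 -> lorentz n q = 0 -> lorentz n r = 0 -> n = 0].

(* Projection of q on the tangent space {v | <p, v> = 0} of the sheet at p: it
   points in the initial direction of the geodesic from p to q. *)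
Definition tangent_dir p q : 'cV[R]_3 := q + lorentz p q *: p.

(* The form is the Riemannian metric (positive definite) on tangent spaces. *)
Definition hyp_angle p q r : R :=
  let u := tangent_dir p q in
  let v := tangent_dir p r in
  acos (lorentz u v / (Num.sqrt (lorentz u u) * Num.sqrt (lorentz v v))).

(* The indices k + 1 and k + 2 are taken mod 3. *)
Definition cross_product p q : 'cV[R]_3 :=
  \col_k (p (k + 1) 0 * q (k + 2) 0 - p (k + 2) 0 * q (k + 1) 0).

(* <line_normal p q, x> = det (p, q, x), hence this is a normal of the plane
   that cuts the sheet along the geodesic through p and q. *)
Definition line_normal p q : 'cV[R]_3 := lorentz_mx *m cross_product p q.

(* Matrix of x |-> x - 2 <n, x> / <n, n> n for n := line_normal p q. *)
Definition line_reflection p q : 'M[R]_3 :=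
  let n := line_normal p q in
  1 - (2 / lorentz n n) *: (n *m n^T *m lorentz_mx).

Definition is_subgroup (G : set 'M[R]_3) : Prop :=
  [/\ G 1, (forall g h, G g -> G h -> G (g * h)) & (forall g, G g -> G g^-1)].

Definition reflection_group p q r : set 'M[R]_3 :=
  smallest is_subgroup
    [set line_reflection p q; line_reflection q r; line_reflection r p].

(* An element of O^+(2, 1) preserves the orientation of the sheet iff its
   determinant is 1. *)
Definition triangle_group p q r : set 'M[R]_3 :=
  [set g | reflection_group p q r g /\ \det g = 1].

Definition translation_length g : R :=
  inf [set hyp_dist x (g *m x) | x in hyp_plane].

(* To be used for orientation-preserving isometries.  These are hyperbolic iff
   their displacement has a positive minimum: the identity and the elliptic
   elements have fixed points, and the displacement of a parabolic element does
   not attain its infimum 0. *)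
Definition hyperbolic g : Prop :=
  0 < translation_length g /\
  exists2 x, hyp_plane x & hyp_dist x (g *m x) = translation_length g.

Definition conj_class (G : set 'M[R]_3) g : set 'M[R]_3 :=
  [set h * g * h^-1 | h in G].

Definition classes_of_length (G : set 'M[R]_3) (l : R) : set (set 'M[R]_3) :=
  [set conj_class G g | g in
    [set g | [/\ G g, hyperbolic g & translation_length g = l]]].

Definition length_spectrum (G : set 'M[R]_3) : set R :=
  [set l | classes_of_length G l !=set0].

Definition multiplicity_ge (G : set 'M[R]_3) (l : R) (m : nat) : Prop :=
  (`I_m #<= classes_of_length G l)%card.

End HyperbolicPlane.

(* Main.v *)
Require Import Defs.
From HB Require Import structures.
From mathcomp Require Import all_boot all_order all_algebra.
From mathcomp Require Import all_classical all_reals all_analysis.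
From mathcomp Require Import ring lra zify.

Set Implicit Arguments.
Unset Strict Implicit.
Unset Printing Implicit Defensive.

Import Order.TTheory GRing.Theory Num.Theory.
Import numFieldNormedType.Exports.
Local Open Scope classical_set_scope.
Local Open Scope ring_scope.

(** The lengths are read off traces, and the traces are arithmetic.

    Geometry.  Let g be an orientation preserving isometry with trace t (on
    R^3) and c = - <x, g x> the hyperbolic cosine of the displacement of a
    point x.  By Cayley-Hamilton - <x, g^2 x> = (t + 1) c - t, and comparing
    with the largest possible value 2 c^2 - 1, reached when x, g x, g^2 x are
    aligned, gives 0 <= (c - 1) (2 c - (t - 1)).  Hence g is hyperbolic if and
    only if t > 3, and its length is then arccosh ((t - 1) / 2)
    (hyperbolic_trace and trace_hyperbolic).

    Arithmetic.  Take unit normals e1, e2 of the sides through the vertex with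
    angle pi/3, and sqrt 2 times a unit normal of the third side for e3.  Their
    Gram matrix is rational and the three reflections preserve the lattice
    Z e1 + Z e2 + Z e3.  The even Clifford algebra of this lattice is a
    quaternion order, with basis 1, e1 e2, e1 e3, e2 e3, and every element of
    the triangle group is x |-> q x q~ / N(q) for some q in the order which has
    norm 1, or has norm 2 and lies in the two-sided ideal of the elements of
    even norm (Gamma_spin).  The trace of that map is tr(q)^2 / N(q) - 1, and
    tr(q) is even on the ideal, so all traces are of the form n^2 - 1 or
    2 n^2 - 1 (spin_group_trace).  The two smallest of these numbers above 3
    are 7 and 8.  They are the traces of two words of length four in the
    reflections, and they give the lengths arccosh 3 = l1 and
    arccosh (7/2) = l3.

    Multiplicity.  An element of trace 7 is not conjugate to its inverse.
    Modulo 3 the form on the lattice has radical spanned by e1 - e2, and the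
    quaternion order maps onto the field with nine elements, which is
    commutative; so conjugation acts trivially on the image of the triangle
    group there, and this image is cyclic of order 4 and generated by the image
    of the chosen element (gamma7_not_conj). *)

(** * Matrices of size 3 *)

Lemma ord3_ind (P : 'I_3 -> Prop) : P 0 -> P 1 -> P 2 -> forall i, P i.
Proof.
move=> P0 P1 P2 [[|[|[|//]]] lti].
- by rewrite (_ : Ordinal lti = 0) //; apply: val_inj.
- by rewrite (_ : Ordinal lti = 1) //; apply: val_inj.
- by rewrite (_ : Ordinal lti = 2) //; apply: val_inj.
Qed.

Lemma sum3 (V : nmodType) (F : 'I_3 -> V) : \sum_i F i = F 0 + F 1 + F 2.
Proof.
rewrite !big_ord_recl big_ord0 addr0 addrA.
by congr (F _ + F _ + F _); apply: val_inj.
Qed.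

Lemma matrix3P (T : Type) (M N : 'M[T]_3) :
  [/\ [/\ M 0 0 = N 0 0, M 0 1 = N 0 1 & M 0 2 = N 0 2],
      [/\ M 1 0 = N 1 0, M 1 1 = N 1 1 & M 1 2 = N 1 2] &
      [/\ M 2 0 = N 2 0, M 2 1 = N 2 1 & M 2 2 = N 2 2]] -> M = N.
Proof.
move=> [[? ? ?] [? ? ?] [? ? ?]]; apply/matrixP => i j.
by elim/ord3_ind: i; elim/ord3_ind: j.
Qed.

Section Matrix3.
Variable K : comNzRingType.
Implicit Type M : 'M[K]_3.

Lemma det2 (N : 'M[K]_2) : \det N = N 0 0 * N 1 1 - N 0 1 * N 1 0.
Proof.
rewrite (expand_det_row N 0) !big_ord_recl big_ord0 addr0 /cofactor !det_mx11.
rewrite !mxE /= expr0 expr1 mul1r mulN1r mulrN.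
by congr (_ * N _ _ - N _ _ * N _ _); apply: val_inj.
Qed.

Definition mx3 (s : seq (seq K)) : 'M[K]_3 := \matrix_(i, j) (nth [::] s i)`_j.

Lemma mxtrace3 M : \tr M = M 0 0 + M 1 1 + M 2 2.
Proof. exact: sum3. Qed.

Lemma det3 M : \det M =
  M 0 0 * (M 1 1 * M 2 2 - M 1 2 * M 2 1)
  - M 0 1 * (M 1 0 * M 2 2 - M 1 2 * M 2 0)
  + M 0 2 * (M 1 0 * M 2 1 - M 1 1 * M 2 0).
Proof.
rewrite (expand_det_row M 0) sum3 /cofactor !det2 !mxE.
have e (i j i' j' : 'I_3) : i = i' -> j = j' -> M i j = M i' j' by move=> -> ->.
rewrite /= expr0 expr1 mul1r !mulN1r /= sqrrN expr1n mul1r mulrN.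
by congr (_ * (_ * _ - _ * _) - _ * (_ * _ - _ * _) + _ * (_ * _ - _ * _));
   apply: e; apply: val_inj.
Qed.

Definition mx3_adj M : 'M[K]_3 :=
  let a i j := M i j in
  let m i j k l := a i k * a j l - a i l * a j k in
  mx3 [:: [:: m 1 2 1 2; m 0 2 2 1; m 0 1 1 2];
          [:: m 1 2 2 0; m 0 2 0 2; m 0 1 2 0];
          [:: m 1 2 0 1; m 0 2 1 0; m 0 1 0 1]].

Lemma mul_mx3_adj M : M *m mx3_adj M = (\det M)%:M.
Proof.
apply/matrixP => i j; rewrite det3.
rewrite mxE sum3; elim/ord3_ind: i; elim/ord3_ind: j; rewrite !mxE /=; ring.
Qed.

(** The form of Cayley-Hamilton in which the adjugate is kept: for an isometry
    of determinant 1 it is the inverse, so that trace and cotrace agree. *)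
Lemma Cayley_Hamilton3 M :
  M *m M - \tr M *: M + (\tr (mx3_adj M))%:M = mx3_adj M.
Proof.
apply/matrixP => i j.
rewrite !mxtrace3.
elim/ord3_ind: i; elim/ord3_ind: j; rewrite !mxE sum3 /=; ring.
Qed.

End Matrix3.

(** * The hyperboloid and the function arccosh *)

Section Lorentz.
Variable R : realType.
Implicit Types (p q u v x y : 'cV[R]_3) (g : 'M[R]_3) (k : R).

Lemma ord_max3 : ord_max = 2 :> 'I_3.
Proof. exact: val_inj. Qed.

Lemma lorentzE p q :
  lorentz p q = p 0 0 * q 0 0 + p 1 0 * q 1 0 - p 2 0 * q 2 0.
Proof.
rewrite /lorentz mul_mx_diag mxE sum3 !mxE !ord_max3 /=; ring.
Qed.

Lemma lorentzC p q : lorentz p q = lorentz q p.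
Proof. by rewrite !lorentzE; ring. Qed.

Lemma lorentzDl u v q : lorentz (u + v) q = lorentz u q + lorentz v q.
Proof. by rewrite !lorentzE !mxE; ring. Qed.

Lemma lorentzZl k u q : lorentz (k *: u) q = k * lorentz u q.
Proof. by rewrite !lorentzE !mxE; ring. Qed.

Lemma lorentzDr u v q : lorentz q (u + v) = lorentz q u + lorentz q v.
Proof. by rewrite !lorentzE !mxE; ring. Qed.

Lemma lorentzZr k u q : lorentz q (k *: u) = k * lorentz q u.
Proof. by rewrite !lorentzE !mxE; ring. Qed.

Lemma lorentzNl u q : lorentz (- u) q = - lorentz u q.
Proof. by rewrite !lorentzE !mxE; ring. Qed.

Lemma lorentzNr u q : lorentz q (- u) = - lorentz q u.
Proof. by rewrite !lorentzE !mxE; ring. Qed.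

Definition lorentz_lin := (lorentzDl, lorentzDr, lorentzZl, lorentzZr, lorentzNl, lorentzNr).

Lemma hyp_planeE x : hyp_plane x <-> lorentz x x = -1 /\ 0 < x 2 0.
Proof. by rewrite /hyp_plane /= ord_max3. Qed.

Lemma col3_eq u v : u 0 0 = v 0 0 -> u 1 0 = v 1 0 -> u 2 0 = v 2 0 -> u = v.
Proof.
by move=> u0 u1 u2; apply/matrixP => i j; rewrite ord1; elim/ord3_ind: i.
Qed.

(** If v is orthogonal to x then, with coordinates (a, b, c) of x and (d, e, f)
    of v, c^2 <v, v> = (d b - e a)^2 + d^2 + e^2. *)
Lemma tangent_ge0 x v : hyp_plane x -> lorentz v x = 0 -> 0 <= lorentz v v.
Proof.
move=> /hyp_planeE[]; rewrite !lorentzE.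
move: (x 0 0) (x 1 0) (x 2 0) (v 0 0) (v 1 0) (v 2 0) => a b c d e f n c0 t.
have -> : d * d + e * e - f * f = ((d * b - e * a) ^+ 2 + d ^+ 2 + e ^+ 2) / c ^+ 2.
  have c2 : c ^+ 2 != 0 by rewrite expf_neq0 // gt_eqF.
  apply: (mulIf c2); rewrite divfK //.
  have fc : f * c = d * a + e * b by lra.
  have -> : (d * d + e * e - f * f) * c ^+ 2 = (d ^+ 2 + e ^+ 2) * c ^+ 2 - (f * c) ^+ 2 by ring.
  have -> : c ^+ 2 = a * a + b * b + 1 by lra.
  rewrite fc; ring.
by rewrite divr_ge0 ?sqr_ge0 // !addr_ge0 ?sqr_ge0.
Qed.

Lemma tangent_eq0 x v : hyp_plane x -> lorentz v x = 0 -> lorentz v v = 0 -> v = 0.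
Proof.
move=> /hyp_planeE[]; rewrite !lorentzE => n c0 t n0.
suff [e0 e1] : v 0 0 = 0 /\ v 1 0 = 0.
  apply: col3_eq; rewrite mxE //.
  by move: n0; rewrite e0 e1 !mulr0 !add0r => /eqP; rewrite oppr_eq0 mulf_eq0 orbb => /eqP.
move: (x 0 0) (x 1 0) (x 2 0) (v 0 0) (v 1 0) (v 2 0) n c0 t n0 => a b c d e f n c0 t n0.
have s0 : (d * b - e * a) ^+ 2 + d ^+ 2 + e ^+ 2 = 0.
  have fc : f * c = d * a + e * b by lra.
  have <- : (d * d + e * e - f * f) * c ^+ 2 = (d * b - e * a) ^+ 2 + d ^+ 2 + e ^+ 2.
    have -> : (d * d + e * e - f * f) * c ^+ 2 = (d ^+ 2 + e ^+ 2) * c ^+ 2 - (f * c) ^+ 2 by ring.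
    have -> : c ^+ 2 = a * a + b * b + 1 by lra.
    rewrite fc; ring.
  by rewrite n0 mul0r.
have := sqr_ge0 (d * b - e * a); have := sqr_ge0 d; have := sqr_ge0 e => h1 h2 h3.
split; apply/eqP; rewrite -sqrf_eq0; apply/eqP; lra.
Qed.

Lemma sheet_lt0 x y : hyp_plane x -> hyp_plane y -> lorentz x y < 0.
Proof.
move=> /hyp_planeE[nx x0] /hyp_planeE[ny y0].
move: nx x0 ny y0; rewrite !lorentzE.
move: (x 0 0) (x 1 0) (x 2 0) (y 0 0) (y 1 0) (y 2 0) => a b c d e f n c0 m f0.
rewrite subr_lt0.
have cf0 : 0 < c * f by rewrite mulr_gt0.
have h : (a * d + b * e) ^+ 2 < (c * f) ^+ 2.
  have -> : (c * f) ^+ 2 = (a * a + b * b + 1) * (d * d + e * e + 1).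
    rewrite exprMn (_ : c ^+ 2 = a * a + b * b + 1); last by lra.
    by rewrite (_ : f ^+ 2 = d * d + e * e + 1); last by lra.
  have := sqr_ge0 (a * e - b * d); have := sqr_ge0 a; have := sqr_ge0 b.
  have := sqr_ge0 d; have := sqr_ge0 e.
  nra.
rewrite ltNge; apply/negP => k.
by move: h; rewrite ltNge ler_sqr ?nnegrE; lra.
Qed.

(** The two sheets of <y, y> = -1 are told apart by the sign of the product
    with a given point of the upper one. *)
Lemma sheet_criterion x y :
  hyp_plane x -> lorentz y y = -1 -> lorentz x y < 0 -> hyp_plane y.
Proof.
move=> hx ny xy; apply/hyp_planeE; split => //.
rewrite ltNge; apply/negP => y0.
have [y2|y2] := eqVneq (y 2 0) 0.
  by move: ny; rewrite lorentzE y2; have := sqr_ge0 (y 0 0); have := sqr_ge0 (y 1 0); nra.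
have : lorentz x (- y) < 0.
  apply: sheet_lt0 => //; apply/hyp_planeE; rewrite !lorentz_lin opprK; split => //.
  by rewrite mxE oppr_gt0 lt_neqAle y2.
by rewrite lorentzNr; lra.
Qed.

(** Positivity of the form on the tangent vector y + <x, y> x at x, whose square
    is <x, y>^2 - 1. *)
Lemma lorentz_le_N1 x y : hyp_plane x -> hyp_plane y -> lorentz x y <= -1.
Proof.
move=> hx hy; have xy := sheet_lt0 hx hy.
have [nx _] := (hyp_planeE x).1 hx; have [ny _] := (hyp_planeE y).1 hy.
have := @tangent_ge0 x (y + lorentz x y *: x) hx.
rewrite !lorentz_lin nx ny (lorentzC y x).
have -> : lorentz x y + lorentz x y * -1 = 0 by ring.
move=> /(_ erefl) h.
rewrite leNgt; apply/negP => k.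
have : 0 < (1 + lorentz x y) * (1 - lorentz x y) by rewrite mulr_gt0; lra.
lra.
Qed.

Lemma lorentz_eq_N1 x y : hyp_plane x -> hyp_plane y -> lorentz x y = -1 -> y = x.
Proof.
move=> hx hy xy.
have [nx _] := (hyp_planeE x).1 hx; have [ny _] := (hyp_planeE y).1 hy.
apply/eqP; rewrite -subr_eq0; apply/eqP.
by apply: (tangent_eq0 hx); rewrite !lorentz_lin ?nx ?ny ?(lorentzC y x) ?xy; lra.
Qed.

End Lorentz.

Section Arccosh.
Variable R : realType.
Implicit Types x y : R.

Lemma arccosh_arg_ge1 x : 1 <= x -> 1 <= x + Num.sqrt (x ^+ 2 - 1).
Proof. by move=> x1; have := sqrtr_ge0 (x ^+ 2 - 1); lra. Qed.

Lemma arccosh1 : arccosh 1 = 0 :> R.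
Proof. by rewrite /arccosh expr1n subrr sqrtr0 addr0 ln1. Qed.

Lemma arccosh_increasing x y : 1 <= x -> x < y -> arccosh x < arccosh y.
Proof.
move=> x1 xy; have y1 : 1 <= y by lra.
rewrite ltr_ln ?posrE; try by rewrite (lt_le_trans ltr01) // arccosh_arg_ge1.
by apply: ltr_leD => //; apply: ler_wsqrtr; nra.
Qed.

Lemma lt_arccosh x y : 1 <= x -> 1 <= y -> (arccosh x < arccosh y) = (x < y).
Proof.
move=> x1 y1; have [xy|yx|->] := ltgtP x y; last by rewrite ltxx.
  exact: arccosh_increasing.
by apply/negbTE; rewrite -leNgt ltW // arccosh_increasing.
Qed.

Lemma le_arccosh x y : 1 <= x -> 1 <= y -> (arccosh x <= arccosh y) = (x <= y).
Proof. by move=> x1 y1; rewrite !leNgt lt_arccosh. Qed.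

Lemma arccosh_ge0 x : 1 <= x -> 0 <= arccosh x.
Proof. by move=> x1; rewrite ln_ge0 // arccosh_arg_ge1. Qed.

Lemma arccosh_gt0 x : 1 <= x -> (0 < arccosh x) = (1 < x).
Proof. by move=> x1; rewrite -arccosh1 lt_arccosh. Qed.

Lemma arccosh_double x : 1 <= x -> 2 * arccosh x = arccosh (2 * x ^+ 2 - 1).
Proof.
move=> x1; have s1 := arccosh_arg_ge1 x1.
have x2 : 0 <= x ^+ 2 - 1 by nra.
rewrite /arccosh mulr_natl -lnXn; last by lra.
congr ln; rewrite sqrrD sqr_sqrtr //.
have -> : (2 * x ^+ 2 - 1) ^+ 2 - 1 = (2 * x) ^+ 2 * (x ^+ 2 - 1) by ring.
rewrite sqrtrM ?sqr_ge0 // sqrtr_sqr ger0_norm; last by lra.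
by ring.
Qed.

End Arccosh.

(** * Trace and translation length *)

Section Isometries.
Variable R : realType.
Implicit Types (p q u v x y : 'cV[R]_3) (g h : 'M[R]_3) (k : R).

Definition orientation_isometry g :=
  [/\ g^T *m lorentz_mx R *m g = lorentz_mx R,
      (forall x, hyp_plane x -> hyp_plane (g *m x)) & \det g = 1].

Definition cosh_disp g x : R := - lorentz x (g *m x).

Lemma lorentz_isometry g x y : g^T *m lorentz_mx R *m g = lorentz_mx R ->
  lorentz (g *m x) (g *m y) = lorentz x y.
Proof. by move=> gJ; rewrite /lorentz -[in RHS]gJ trmx_mul !mulmxA. Qed.

Lemma lorentz_mxK : lorentz_mx R *m lorentz_mx R = 1%:M.
Proof.
apply/matrixP => i j; rewrite mul_diag_mx !mxE.
by elim/ord3_ind: i; elim/ord3_ind: j; rewrite ?ord_max3 /= ?mulr0 ?mulr1 ?mulrNN ?mulr1.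
Qed.

Lemma isometry_inv g : g^T *m lorentz_mx R *m g = lorentz_mx R ->
  lorentz_mx R *m g^T *m lorentz_mx R *m g = 1%:M.
Proof. by move=> gJ; rewrite -!mulmxA (mulmxA g^T) gJ lorentz_mxK. Qed.

Lemma mx3_adj_isometry g : orientation_isometry g ->
  mx3_adj g = lorentz_mx R *m g^T *m lorentz_mx R.
Proof.
move=> [gJ _ g1]; have := mul_mx3_adj g; rewrite g1 => gadj.
by rewrite -[LHS]mul1mx -(isometry_inv gJ) -(mulmxA _ g) gadj mulmx1.
Qed.

(** Cayley-Hamilton for g, where g^-1 is the adjoint of g for the form. *)
Lemma lorentz_sq g x y : orientation_isometry g ->
  lorentz y (g *m (g *m x)) =
  \tr g * lorentz y (g *m x) - \tr g * lorentz y x + lorentz (g *m y) x.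
Proof.
move=> og; have adjg := mx3_adj_isometry og.
have trg : \tr (mx3_adj g) = \tr g.
  by rewrite adjg mxtrace_mulC mulmxA lorentz_mxK mul1mx mxtrace_tr.
have := Cayley_Hamilton3 g; rewrite trg adjg => CH.
have -> : g *m (g *m x) = \tr g *: (g *m x) - \tr g *: x +
    (lorentz_mx R *m g^T *m lorentz_mx R) *m x.
  rewrite -CH mulmxA !mulmxDl mulNmx -scalemxAl mul_scalar_mx.
  move: (g *m g *m x) (\tr g *: (g *m x)) (\tr g *: x) => a b c.
  by apply/matrixP => i j; rewrite !mxE; ring.
rewrite !lorentz_lin; congr (_ + _).
by rewrite /lorentz trmx_mul !mulmxA -(mulmxA y^T) lorentz_mxK mulmx1.
Qed.

Lemma cosh_disp_ge1 g x : orientation_isometry g -> hyp_plane x -> 1 <= cosh_disp g x.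
Proof.
move=> [_ gH _] hx; rewrite /cosh_disp.
by have := lorentz_le_N1 hx (gH _ hx); lra.
Qed.

(** All products of x, g x, g^2 x, g^3 x are determined by the trace and by the
    displacement of x; the conjunction is a rewriting rule. *)
Lemma orbit_gram g x : orientation_isometry g -> hyp_plane x ->
  let c := cosh_disp g x in
  let e := \tr g - (\tr g + 1) * c in
  let f := \tr g * e + \tr g * c - 1 in
  let x1 := g *m x in let x2 := g *m x1 in let x3 := g *m x2 in
  ((lorentz x x = -1) * (lorentz x1 x1 = -1) * (lorentz x2 x2 = -1) *
   ((lorentz x x1 = - c) * (lorentz x1 x = - c) * (lorentz x1 x2 = - c) *
   (lorentz x2 x1 = - c) * (lorentz x2 x3 = - c) *
   ((lorentz x x2 = e) * (lorentz x2 x = e) * (lorentz x1 x3 = e) *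
   (lorentz x x3 = f))))%type.
Proof.
move=> og hx c e f x1 x2 x3; have [gJ gH _] := og; have [x00 _] := (hyp_planeE x).1 hx.
have gg u v : lorentz (g *m u) (g *m v) = lorentz u v by exact: lorentz_isometry.
have x01 : lorentz x x1 = - c by rewrite /c /cosh_disp opprK.
have x10 : lorentz x1 x = - c by rewrite lorentzC.
have x02 : lorentz x x2 = e by rewrite lorentz_sq // x01 x10 x00 /e; ring.
have x03 : lorentz x x3 = f by rewrite lorentz_sq // x02 x01 gg x00 /f; ring.
by rewrite !(lorentzC x2 x) !(lorentzC x2 x1) !gg !x00 !x01 !x10 !x02 !x03.
Qed.

(** The vector w below is orthogonal to g x, hence <w, w> >= 0; the right hand
    side is half of <w, w>.  The vector w measures the failure of x, g x and
    g^2 x to be equally spaced on a geodesic. *)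
Lemma cosh_disp_quad g x : orientation_isometry g -> hyp_plane x ->
  0 <= (cosh_disp g x - 1) * (2 * cosh_disp g x - (\tr g - 1)).
Proof.
move=> og hx; have [gJ gH _] := og; have [nx _] := (hyp_planeE x).1 hx.
set c := cosh_disp g x.
have gram := orbit_gram og hx; have hgx := gH _ hx.
pose w := g *m (g *m x) - (2 * c) *: (g *m x) + x.
have := @tangent_ge0 _ _ w hgx; rewrite !lorentz_lin.
rewrite !gram -/c.
move=> /(_ ltac:(ring)); lra.
Qed.

Lemma translation_length_le g x : orientation_isometry g -> hyp_plane x ->
  translation_length g <= arccosh (cosh_disp g x).
Proof.
move=> og hx; apply: ge_inf; last by exists x.
by exists 0 => _ [y hy <-]; apply: arccosh_ge0; apply: cosh_disp_ge1.
Qed.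

(** Let x minimize the displacement.  The midpoint m of x and g x is moved at
    least as much as x, which is the inequality opposite to cosh_disp_quad.  So
    equality holds there, and 2 c = tr g - 1 because c > 1. *)
Lemma hyperbolic_trace g : orientation_isometry g -> hyperbolic g ->
  3 < \tr g /\ translation_length g = arccosh ((\tr g - 1) / 2).
Proof.
move=> og [tl0 [x hx dx]]; have [gJ gH _] := og; have [nx _] := (hyp_planeE x).1 hx.
set c := cosh_disp g x.
have gram := orbit_gram og hx.
have tlE : translation_length g = arccosh c by rewrite -dx.
have c1 : 1 < c by rewrite -arccosh_gt0 ?cosh_disp_ge1 // -tlE.
(* m is the midpoint of x and g x: the square of x + g x is - (2 + 2 c). *)
pose k := (Num.sqrt (2 + 2 * c))^-1.
have k0 : 0 < k by rewrite invr_gt0 sqrtr_gt0; lra.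
have k2 : k ^+ 2 * (2 + 2 * c) = 1.
  by rewrite exprVn sqr_sqrtr ?mulVf //; first (by apply: lt0r_neq0; lra); lra.
pose m := k *: (x + g *m x).
have hm : hyp_plane m.
  apply: (sheet_criterion hx); rewrite !lorentz_lin !gram -/c.
    by transitivity (- (k ^+ 2 * (2 + 2 * c))); [ring | rewrite k2].
  rewrite pmulr_rlt0 //; lra.
have cm : cosh_disp g m = k ^+ 2 * (1 + 2 * c + (\tr g + 1) * c - \tr g).
  rewrite /cosh_disp /m -scalemxAr mulmxDr !lorentz_lin !gram -/c; ring.
have le_cm : c <= cosh_disp g m.
  rewrite -le_arccosh ?cosh_disp_ge1 //.
  by rewrite -tlE translation_length_le.
have : c * (2 + 2 * c) <= 1 + 2 * c + (\tr g + 1) * c - \tr g.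
  move: le_cm; rewrite cm -(ler_pM2r (_ : 0 < 2 + 2 * c)); last by lra.
  move=> /le_trans; apply; rewrite mulrAC k2; lra.
have := cosh_disp_quad og hx; rewrite -/c => q1 q2.
have /eqP : (c - 1) * (2 * c - (\tr g - 1)) = 0 by apply/le_anti/andP; split => //; lra.
rewrite mulf_eq0 subr_eq0 gt_eqF //= subr_eq0 => /eqP tE.
by split; [lra | rewrite tlE; congr arccosh; lra].
Qed.

(** An isometry fixing the three points (0, 0, 1), (1, 0, sqrt 2) and
    (0, 1, sqrt 2), which span R^3, is the identity, of trace 3. *)
Lemma exists_moved_point g : orientation_isometry g -> 3 < \tr g ->
  exists2 x, hyp_plane x & 1 < cosh_disp g x.
Proof.
move=> og t3; have [gJ gH _] := og.
apply: contrapT => nomove.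
have fixed x : hyp_plane x -> g *m x = x.
  move=> hx; apply: (lorentz_eq_N1 hx (gH _ hx)).
  apply/le_anti/andP; split; first exact: lorentz_le_N1 (gH _ hx).
  rewrite leNgt; apply/negP => mv.
  by apply: nomove; exists x => //; rewrite /cosh_disp; lra.
pose s : R := Num.sqrt 2.
have s2 : s * s = 2 by rewrite -expr2 sqr_sqrtr.
have s0 : 0 < s by rewrite sqrtr_gt0.
pose pt a b c : 'cV[R]_3 := \col_i [:: a; b; c]`_i.
have fixpt a b c : a * a + b * b - c * c = -1 -> 0 < c ->
    forall i, g i 0 * a + g i 1 * b + g i 2 * c = pt a b c i 0.
  move=> n c0 i; rewrite -{1}(fixed (pt a b c)); last first.
    by apply/hyp_planeE; rewrite lorentzE !mxE.
  by rewrite [in RHS]mxE sum3 !mxE.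
have f0 := fixpt 0 0 1 ltac:(ring) ltr01.
have f1 := fixpt 1 0 s ltac:(rewrite s2; ring) s0.
have f2 := fixpt 0 1 s ltac:(rewrite s2; ring) s0.
have g22 : g 2 2 = 1 by have := f0 2; rewrite mxE /=; lra.
have g02 : g 0 2 = 0 by have := f0 0; rewrite mxE /=; lra.
have g12 : g 1 2 = 0 by have := f0 1; rewrite mxE /=; lra.
have := f1 0; have := f2 1; rewrite !mxE /= g02 g12 mxtrace3 g22 in t3 *.
lra.
Qed.

(** The operator (g - 1)^2 kills the fixed vectors of g, so for a point x with
    g x <> x the vector z = (g - 1)^2 x lies in the plane of the axis; it is
    timelike when tr g > 3 and yields a point where cosh_disp_quad is an
    equality.  A fixed point y of g cannot exist, since <y, z> would vanish. *)
Lemma trace_hyperbolic g : orientation_isometry g -> 3 < \tr g ->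
  hyperbolic g /\ translation_length g = arccosh ((\tr g - 1) / 2).
Proof.
move=> og t3; have [gJ gH _] := og.
have [x hx c1] := exists_moved_point og t3.
have [nx _] := (hyp_planeE x).1 hx; have hgx := gH _ hx.
set c := cosh_disp g x in c1.
have gram := orbit_gram og hx.
pose z := g *m (g *m x) - 2 *: (g *m x) + x.
have zz : lorentz z z = - (2 * (\tr g - 3) * (c - 1)).
  by rewrite !lorentz_lin !gram -/c; ring.
have zgz : 2 * lorentz z (g *m z) = (\tr g - 1) * lorentz z z.
  rewrite zz /z !(mulmxDr, mulmxN, =^~ scalemxAr) !lorentz_lin.
  by rewrite !gram -/c; ring.
have zz0 : 0 < - lorentz z z by rewrite zz opprK !mulr_gt0 //; lra.
pose k := (Num.sqrt (- lorentz z z))^-1.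
have k0 : 0 < k by rewrite invr_gt0 sqrtr_gt0.
have k2 : k ^+ 2 * (- lorentz z z) = 1.
  by rewrite exprVn sqr_sqrtr ?mulVf ?gt_eqF // ltW.
have ha : hyp_plane (k *: z).
  apply: (sheet_criterion hgx).
    rewrite lorentzZl lorentzZr.
    by transitivity (- (k ^+ 2 * - lorentz z z)); [ring | rewrite k2].
  rewrite !lorentz_lin !gram -/c.
  by rewrite pmulr_rlt0 //; lra.
have ca : cosh_disp g (k *: z) = (\tr g - 1) / 2.
  rewrite /cosh_disp -scalemxAr lorentzZl lorentzZr.
  transitivity ((\tr g - 1) / 2 * (k ^+ 2 * - lorentz z z)); last by rewrite k2 mulr1.
  rewrite (_ : lorentz z (g *m z) = (\tr g - 1) / 2 * lorentz z z); first by ring.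
  by lra.
have tl : translation_length g = arccosh ((\tr g - 1) / 2).
  apply/le_anti/andP; split; first by rewrite -ca translation_length_le.
  apply: lb_le_inf; first by exists (hyp_dist x (g *m x)), x.
  move=> _ [y hy <-]; rewrite le_arccosh; [|lra|exact: cosh_disp_ge1].
  have : 1 < cosh_disp g y.
    rewrite lt_neqAle cosh_disp_ge1 // andbT; apply/eqP => cy1.
    have fy : g *m y = y.
      by apply: (lorentz_eq_N1 hy (gH _ hy)); rewrite /cosh_disp in cy1; lra.
    have yg v : lorentz y (g *m v) = lorentz y v by rewrite -{1}fy lorentz_isometry.
    have := sheet_lt0 hy ha; rewrite !lorentz_lin !yg; lra.
  have := cosh_disp_quad og hy; rewrite -/(cosh_disp g y) => q c1y.
  by move: q; rewrite pmulr_rge0 ?subr_gt0 //; lra.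
split => //; split; last by exists (k *: z) => //; rewrite tl -ca.
by rewrite tl arccosh_gt0; lra.
Qed.
End Isometries.

(** * Reflections and the normals of the sides of the triangle *)

Section Cosines.
Variable R : realType.

Lemma cos_pi4_gt0 : 0 < cos (pi / 4) :> R.
Proof. by rewrite cos_gt0_pihalf //; have := @pi_gt0 R; lra. Qed.

Lemma cos_pi4_sq : cos (pi / 4) ^+ 2 = 1 / 2 :> R.
Proof.
have := cos_mulr2n (pi / 4 : R).
rewrite (_ : (pi / 4) *+ 2 = pi / 2 :> R); last by field.
by rewrite cos_pihalf; lra.
Qed.

(** The triple angle formula at pi / 3 reads (c + 1) (2 c - 1)^2 = 0. *)
Lemma cos_pi3 : cos (pi / 3) = 1 / 2 :> R.
Proof.
have c0 : 0 < cos (pi / 3) :> R by rewrite cos_gt0_pihalf //; have := @pi_gt0 R; lra.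
have triple (x : R) : cos (x + x *+ 2) = 4 * cos x ^+ 3 - 3 * cos x.
  have s2 := sin2cos2 x.
  rewrite cosD cos_mulr2n sin_mulr2n.
  transitivity (cos x * (2 * cos x ^+ 2 - 1) - 2 * cos x * sin x ^+ 2); first by ring.
  by rewrite s2; ring.
have := triple (pi / 3); rewrite (_ : pi / 3 + (pi / 3) *+ 2 = pi); last first.
  by field.
move: c0; rewrite cospi; set c := cos (pi / 3) => c0 c3.
have : (c + 1) * (2 * c - 1) ^+ 2 = 0.
  by transitivity (4 * c ^+ 3 - 3 * c + 1); [ring | rewrite -c3; ring].
move/eqP; rewrite mulf_eq0 sqrf_eq0 => /orP[] /eqP; lra.
Qed.

(** Outside [-1, 1] the function acos takes the default value 0. *)
Lemma acos_eq_cos (x t : R) : acos x = t -> t != 0 -> x = cos t.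
Proof.
move=> <-; rewrite unlock; case: xgetP => [y _ [_ yx] _|_ /eqP[] //].
by rewrite yx.
Qed.
End Cosines.

Section Reflections.
Variable R : realType.
Implicit Types (p q r s n v x y : 'cV[R]_3) (k : R) (g : 'M[R]_3).

Definition reflection n : 'M[R]_3 :=
  1 - (2 / lorentz n n) *: (n *m n^T *m lorentz_mx R).

Lemma reflection_mulmx n v :
  reflection n *m v = v - (2 * lorentz n v / lorentz n n) *: n.
Proof.
rewrite /reflection mulmxDl mul1mx mulNmx -scalemxAl; congr (_ - _).
rewrite -!mulmxA (mulmxA n^T) [X in _ *m X]mx11_scalar -/(lorentz n v).
by rewrite mul_mx_scalar scalerA mulrAC.
Qed.

Lemma reflectionZ k n : k != 0 -> reflection (k *: n) = reflection n.
Proof.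
move=> k0; rewrite /reflection; have -> : (k *: n)^T = k *: n^T by rewrite linearZ.
rewrite !lorentz_lin -scalemxAl -scalemxAr -!scalemxAl !scalerA.
congr (1 - _ *: _); rewrite !invfM.
have [->|nn] := eqVneq (lorentz n n) 0; first by rewrite invr0; ring.
by field; rewrite k0 nn.
Qed.

(** The matrix determinant lemma: det (1 - k n n^T J) = 1 - k <n, n>. *)
Lemma det_reflection n : lorentz n n != 0 -> \det (reflection n) = -1.
Proof.
move=> nn; rewrite /reflection.
set k := 2 / _; have kn : k * lorentz n n = 2 by rewrite divfK.
suff -> : \det (1 - k *: (n *m n^T *m lorentz_mx R)) = 1 - k * lorentz n n by rewrite kn; ring.
have E i j : (1 - k *: (n *m n^T *m lorentz_mx R)) i j =
   (i == j)%:R - k * (n i 0 * n j 0 * (if j == 2 then -1 else 1)).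
  by rewrite mul_mx_diag !mxE big_ord1 !mxE ord_max3.
rewrite det3 !E lorentzE /=; ring.
Qed.

Lemma isometryP g : (forall x y, lorentz (g *m x) (g *m y) = lorentz x y) ->
  g^T *m lorentz_mx R *m g = lorentz_mx R.
Proof.
move=> gP; apply/matrixP => i j.
have E (M : 'M[R]_3) : M i j = ((delta_mx i 0 : 'cV_3)^T *m M *m (delta_mx j 0 : 'cV_3)) 0 0.
  by rewrite trmx_delta -rowE -colE !mxE.
rewrite 2!E; move: (gP (delta_mx i 0) (delta_mx j 0)).
by rewrite /lorentz trmx_mul !mulmxA.
Qed.

Lemma reflection_isometry n x y : lorentz n n != 0 ->
  lorentz (reflection n *m x) (reflection n *m y) = lorentz x y.
Proof.
move=> nn; rewrite !reflection_mulmx !lorentz_lin (lorentzC x n).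
by field.
Qed.

Lemma reflectionK n : lorentz n n != 0 -> reflection n * reflection n = 1.
Proof.
move=> nn; have K v : reflection n *m (reflection n *m v) = v.
  rewrite !reflection_mulmx !lorentz_lin.
  by apply/matrixP => i j; rewrite !mxE; field.
apply/matrixP => i j; have /matrixP/(_ i 0) := K (delta_mx j 0).
by rewrite mulmxA -colE !mxE andbT.
Qed.

Lemma reflection_hyp_plane n x : 0 < lorentz n n -> hyp_plane x ->
  hyp_plane (reflection n *m x).
Proof.
move=> nn hx; have [nx _] := (hyp_planeE x).1 hx.
apply: (sheet_criterion hx); first by rewrite reflection_isometry ?gt_eqF.
rewrite reflection_mulmx !lorentz_lin nx (lorentzC x n).
have : 0 <= 2 * lorentz n x / lorentz n n * lorentz n x.
  rewrite (_ : _ * _ = 2 * (lorentz n x) ^+ 2 / lorentz n n); last by ring.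
  by apply: divr_ge0; [rewrite mulr_ge0 ?sqr_ge0 | exact: ltW].
lra.
Qed.

End Reflections.

Section TriangleNormals.
Variable R : realType.
Implicit Types (p q r s : 'cV[R]_3) (t : R).

Lemma line_normalE p q : line_normal p q =
  \col_i [:: p 1 0 * q 2 0 - p 2 0 * q 1 0; p 2 0 * q 0 0 - p 0 0 * q 2 0;
             p 1 0 * q 0 0 - p 0 0 * q 1 0]`_i.
Proof.
have e1 : (1 + 1 = 2 :> 'I_3) by apply: val_inj.
have e2 : (1 + 2 = 0 :> 'I_3) by apply: val_inj.
have e3 : (2 + 1 = 0 :> 'I_3) by apply: val_inj.
have e4 : (2 + 2 = 1 :> 'I_3) by apply: val_inj.
rewrite /line_normal /cross_product.
apply/matrixP => i j; rewrite ord1 mul_diag_mx !mxE.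
elim/ord3_ind: i; rewrite ?ord_max3 /= ?add0r ?e1 ?e2 ?e3 ?e4; ring.
Qed.

Lemma line_normalC p q : line_normal q p = - line_normal p q.
Proof.
rewrite !line_normalE; apply/matrixP => i j; rewrite !mxE.
by elim/ord3_ind: i => /=; ring.
Qed.

(** Lagrange's identity, with the sign of a form of signature (2, 1). *)
Lemma lorentz_line_normal p q r s :
  lorentz (line_normal p q) (line_normal r s) =
  lorentz p s * lorentz q r - lorentz p r * lorentz q s.
Proof. by rewrite !line_normalE !lorentzE !mxE /=; ring. Qed.

(** At p, taking the cross product with p is a quarter turn of the tangent
    plane, so the angle between two sides is the angle between their normals. *)
Lemma lorentz_tangent_dir p q r : lorentz p p = -1 ->
  lorentz (tangent_dir p q) (tangent_dir p r) =
  lorentz (line_normal p q) (line_normal p r).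
Proof.
move=> pp; rewrite lorentz_line_normal /tangent_dir !lorentz_lin pp (lorentzC q p); ring.
Qed.

(** Since cos t is not zero, neither are the square roots in the denominator of
    the definition of the angle: the normals are spacelike. *)
Lemma angle_between_sides p q r t : lorentz p p = -1 -> hyp_angle p q r = t ->
  0 < t < pi / 2 ->
  let m := line_normal p q in let n := line_normal p r in
  [/\ 0 < lorentz m m, 0 < lorentz n n &
      lorentz m n = cos t * (Num.sqrt (lorentz m m) * Num.sqrt (lorentz n n))].
Proof.
move=> pp + /andP[t0 t1] m n; rewrite /hyp_angle !lorentz_tangent_dir //.
move=> /acos_eq_cos -/(_ (lt0r_neq0 t0)); rewrite -/m -/n => ct.
have c0 : 0 < cos t by rewrite cos_gt0_pihalf //; lra.
have sm : 0 < lorentz m m.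
  rewrite ltNge; apply/negP => m0; move: c0; rewrite -ct ler0_sqrtr // mul0r invr0 mulr0.
  by rewrite ltxx.
have sn : 0 < lorentz n n.
  rewrite ltNge; apply/negP => n0; move: c0; rewrite -ct (ler0_sqrtr n0) mulr0 invr0 mulr0.
  by rewrite ltxx.
split => //; rewrite -ct divfK //.
by rewrite mulf_neq0 // gt_eqF // sqrtr_gt0.
Qed.

(** The normals oriented cyclically make obtuse angles, hence the signs.  The
    factor sqrt 2 = 2 cos (pi / 4) in e3 makes the Gram matrix rational and the
    coefficients 2 <ei, ej> / <ei, ei> of the reflections integers. *)
Lemma triangle_normals (A B C : 'cV[R]_3) :
  hyp_triangle A B C -> hyp_angle A B C = pi / 3 ->
  hyp_angle B C A = pi / 4 -> hyp_angle C A B = pi / 4 ->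
  exists e1 e2 e3 : 'cV[R]_3,
    [/\ line_reflection C A = reflection e1,
        line_reflection A B = reflection e2 &
        line_reflection B C = reflection e3] /\
    [/\ lorentz e1 e1 = 1, lorentz e2 e2 = 1 & lorentz e3 e3 = 2] /\
    [/\ lorentz e1 e2 = - (1 / 2), lorentz e1 e3 = -1 & lorentz e2 e3 = -1].
Proof.
move=> [/hyp_planeE[AA _] /hyp_planeE[BB _] /hyp_planeE[CC _] _] hA hB hC.
have pi0 := @pi_gt0 R.
have [] := angle_between_sides AA hA; first by lra.
have [] := angle_between_sides BB hB; first by lra.
have [] := angle_between_sides CC hC; first by lra.
rewrite (line_normalC B C) (line_normalC A B) (line_normalC C A).
set a := line_normal B C; set b := line_normal C A; set c := line_normal A B.
rewrite !lorentz_lin !opprK cos_pi3 => b0 a0 ba _ c0 ac _ _ cb.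
have w2 := cos_pi4_sq R; have w0 := cos_pi4_gt0 R.
set w := cos (pi / 4) in ba ac w2 w0.
pose la := Num.sqrt (lorentz a a); pose lb := Num.sqrt (lorentz b b).
pose lc := Num.sqrt (lorentz c c).
have la0 : 0 < la by rewrite sqrtr_gt0.
have lb0 : 0 < lb by rewrite sqrtr_gt0.
have lc0 : 0 < lc by rewrite sqrtr_gt0.
have la2 : lorentz a a = la ^+ 2 by rewrite sqr_sqrtr // ltW.
have lb2 : lorentz b b = lb ^+ 2 by rewrite sqr_sqrtr // ltW.
have lc2 : lorentz c c = lc ^+ 2 by rewrite sqr_sqrtr // ltW.
have {}ba : lorentz b a = - (w * (lb * la)) by rewrite -ba opprK.
have {}ac : lorentz a c = - (w * (la * lc)) by rewrite -ac opprK.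
have {}cb : lorentz c b = - (1 / 2 * (lc * lb)) by rewrite -cb opprK.
exists (lb^-1 *: b), (lc^-1 *: c), ((2 * w / la) *: a).
have nz := (lt0r_neq0 la0, lt0r_neq0 lb0, lt0r_neq0 lc0, lt0r_neq0 w0).
split; first by rewrite !reflectionZ ?invr_eq0 ?mulf_neq0 ?invr_eq0 ?nz.
have ww : w * w = 1 / 2 by rewrite -expr2.
rewrite !lorentz_lin (lorentzC b c) (lorentzC c a) la2 lb2 lc2 ba ac cb.
split; split.
- by field; rewrite nz.
- by field; rewrite nz.
- by transitivity (4 * (w * w)); [field; rewrite nz | rewrite ww; field].
- by field; rewrite !nz.
- by transitivity (- (2 * (w * w))); [field; rewrite !nz | rewrite ww; field].
- by transitivity (- (2 * (w * w))); [field; rewrite !nz | rewrite ww; field].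
Qed.

End TriangleNormals.

(** * The quaternion order of the triangle *)

Section Quaternions.

(** The quadruple stands for a + b e1 e2 + c e1 e3 + d e2 e3 in the Clifford
    algebra with e1^2 = e2^2 = 1, e3^2 = 2, e1 e2 + e2 e1 = -1 and
    e1 e3 + e3 e1 = e2 e3 + e3 e2 = -2, in which ei ej + ej ei = 2 <ei, ej> for
    the normals ei of triangle_normals.  The operations below are the product,
    the norm q q~ and the trace q + q~, where ~ reverses products of the ei. *)
Record quat := Quat {qa : int; qb : int; qc : int; qd : int}.
Implicit Types q r : quat.

Definition qmul q r : quat :=
  let: Quat a b c d := q in let: Quat a' b' c' d' := r in
  Quat (a * a' - b * b' + 2 * (c * b') - 2 * (c * c') - 4 * (d * b') + 2 * (d * c')
    - 2 * (d * d'))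
       (a * b' + b * a' - b * b' - 2 * (c * b') - 2 * (c * d') - 2 * (d * b')
         + 2 * (d * c'))
       (a * c' - b * c' + b * d' + c * a' - 2 * (c * c') - 2 * (c * d') - d * b')
       (a * d' - b * c' + c * b' + d * a' - d * b' - 2 * (d * c') - 2 * (d * d')).

Definition qnorm q : int :=
  let: Quat a b c d := q in
  a * a - a * b - 2 * (a * c) - 2 * (a * d) + b * b - 2 * (b * c) + 4 * (b * d)
  + 2 * (c * c) - 2 * (c * d) + 2 * (d * d).

Definition qtrace q : int := let: Quat a b c d := q in 2 * a - b - 2 * c - 2 * d.

Definition qdouble q : quat := let: Quat a b c d := q in Quat (2 * a) (2 * b) (2 * c) (2 * d).

(** The matrix of x |-> q x q~ in the basis e1, e2, e3. *)
Definition qrot q : 'M[int]_3 :=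
  let: Quat a b c d := q in
  mx3 [:: [:: a * a - 2 * (a * b) - 4 * (a * c) - 2 * (a * d) + 6 * (b * c)
    + 2 * (b * d) + 2 * (c * c) + 4 * (c * d) + 2 * (d * d);
              2 * (a * b) - 2 * (a * c) - b * b - 4 * (b * c) - 2 * (b * d)
                + 6 * (c * c);
              - 2 * (a * b) + 4 * (a * c) + 4 * (b * b) - 4 * (b * c) + 4 * (b * d)
                - 4 * (c * c) - 4 * (c * d)];
          [:: - 2 * (a * b) - 2 * (a * d) + b * b + 2 * (b * c) + 6 * (b * d)
            + 6 * (d * d);
              a * a - 2 * (a * c) - 4 * (a * d) - b * b - 2 * (b * d) + 2 * (c * c)
                + 4 * (c * d) + 2 * (d * d);
              2 * (a * b) + 4 * (a * d) + 2 * (b * b) - 4 * (b * c) - 4 * (c * d)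
                - 4 * (d * d)];
          [:: - 2 * (a * c) + a * d + b * c + b * d + 2 * (c * c) - 2 * (c * d)
            + 2 * (d * d);
              a * c - 2 * (a * d) - 2 * (b * c) + b * d + 2 * (c * c) - 2 * (c * d)
                + 2 * (d * d);
              a * a - a * b + b * b - 2 * (c * c) + 2 * (c * d) - 2 * (d * d)]].

Lemma qnormM q r : qnorm (qmul q r) = qnorm q * qnorm r.
Proof. by case: q => a b c d; case: r => a' b' c' d' /=; ring. Qed.

Lemma qrotM q r : qrot (qmul q r) = qrot q *m qrot r.
Proof.
case: q => a b c d; case: r => a' b' c' d' /=; apply/matrixP => i j.
rewrite [RHS]mxE sum3.
elim/ord3_ind: i; elim/ord3_ind: j; rewrite !mxE /=; ring.
Qed.

Lemma qnorm_double q : qnorm (qdouble q) = 4 * qnorm q.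
Proof. by case: q => a b c d /=; ring. Qed.

Lemma qrot_double q : qrot (qdouble q) = 4 *: qrot q.
Proof.
case: q => a b c d /=; apply/matrixP => i j.
elim/ord3_ind: i; elim/ord3_ind: j; rewrite !mxE /=; ring.
Qed.

(** On the whole odd part of the Clifford algebra x |-> q x q~ has trace tr(q)^2;
    this part is the span of the ei plus a central line, on which the map is
    multiplication by the norm. *)
Lemma mxtrace_qrot q : \tr (qrot q) = qtrace q ^+ 2 - qnorm q.
Proof. by case: q => a b c d /=; rewrite mxtrace3 !mxE /=; ring. Qed.

(** Modulo 2 the norm is a^2 + a b + b^2, so the elements of even norm are those
    with a and b even; they form a two-sided ideal, of square 2 times the
    order. *)
Definition admissible q : Prop :=
  qnorm q = 1 \/ qnorm q = 2 /\ exists x y, qa q = 2 * x /\ qb q = 2 * y.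

End Quaternions.

(** * The triangle group as a group of quaternions *)

(** A product of two elements of norm 2 has norm 4, and is twice an element of
    norm 1 because both factors are in the ideal of even norm. *)
Lemma admissible_mul q r : admissible q -> admissible r ->
  exists2 s, admissible s & qmul q r = s \/ qmul q r = qdouble s.
Proof.
move=> + + ; rewrite /admissible => -[nq|[nq [x [y [+ +]]]]] [nr|[nr [z [t [+ +]]]]].
- by exists (qmul q r); [left; rewrite qnormM nq nr | left].
- case: q r nq nr => a b c d [a' b' c' d'] nq nr /= az bt.
  exists (qmul (Quat a b c d) (Quat a' b' c' d')); last by left.
  right; split; first by rewrite qnormM nq nr.
  exists (a * z - b * t + 2 * (c * t) - c * c' - 4 * (d * t) + d * c' - d * d'),
         (a * t + b * z - b * t - 2 * (c * t) - c * d' - 2 * (d * t) + d * c').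
  by split => /=; rewrite az bt; ring.
- case: q r nq nr => a b c d [a' b' c' d'] nq nr /= ax yb.
  exists (qmul (Quat a b c d) (Quat a' b' c' d')); last by left.
  right; split; first by rewrite qnormM nq nr.
  exists (x * a' - y * b' + c * b' - c * c' - 2 * (d * b') + d * c' - d * d'),
         (x * b' + y * a' - y * b' - c * b' - c * d' - d * b' + d * c').
  by split => /=; rewrite ax yb; ring.
- case: q r nq nr => a b c d [a' b' c' d'] nq nr /= az bt ax yb.
  pose s := Quat (2 * (x * z) - 2 * (y * t) + 2 * (c * t) - c * c' - 4 * (d * t) + d * c' - d * d')
         (2 * (x * t) + 2 * (y * z) - 2 * (y * t) - 2 * (c * t) - c * d' - 2 * (d * t) + d * c')
         (x * c' - y * c' + y * d' + c * z - c * c' - c * d' - d * t)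
         (x * d' - y * c' + c * t + d * z - d * t - d * c' - d * d').
  have e : qmul (Quat a b c d) (Quat a' b' c' d') = qdouble s.
    by rewrite /= ax yb az bt; congr Quat; ring.
  exists s; last by right.
  left; apply: (@mulfI _ 4) => //.
  by rewrite -qnorm_double -e qnormM nq nr.
Qed.

Section InvolutionGroups.
Variable R : realType.

(** Induction on words.  Inverses cost nothing: the elements g such that left
    multiplication by g and by its inverse preserve Q form a subgroup, and a
    generator is its own inverse. *)
Lemma involution_group_ind (S : set 'M[R]_3) (Q : 'M[R]_3 -> Prop) :
  (forall s, S s -> s * s = 1) -> Q 1 ->
  (forall s g, S s -> Q g -> Q (s * g)) ->
  forall g, smallest (@is_subgroup R) S g -> Q g.
Proof.
move=> SS Q1 QS.
pose K : set 'M[R]_3 := [set g | [/\ g \is a GRing.unit,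
  forall h, Q h -> Q (g * h) & forall h, Q h -> Q (g^-1 * h)]].
have KP : smallest (@is_subgroup R) S `<=` K.
  apply: smallest_sub.
    split.
    - by split; rewrite ?unitr1 ?invr1 // => h; rewrite mul1r.
    - move=> g h [ug Kg Kg'] [uh Kh Kh']; split; first by rewrite unitrMr.
        by move=> k Qk; rewrite -mulrA; apply/Kg/Kh.
      by move=> k Qk; rewrite invrM // -mulrA; apply/Kh'/Kg'.
    - by move=> g [ug Kg Kg']; split; rewrite ?unitrV ?invrK.
  move=> s Ss; have us : s \is a GRing.unit by apply/unitrP; exists s; rewrite SS.
  have sV : s^-1 = s by apply: (mulrI us); rewrite mulrV ?SS.
  by split; rewrite ?sV // => h; apply: QS.
by move=> g /KP[_ /(_ 1 Q1)]; rewrite mulr1.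
Qed.
End InvolutionGroups.

Section Triangle344.
Variables (R : realType) (e1 e2 e3 : 'cV[R]_3).
Hypothesis e11 : lorentz e1 e1 = 1.
Hypothesis e22 : lorentz e2 e2 = 1.
Hypothesis e33 : lorentz e3 e3 = 2.
Hypothesis e12 : lorentz e1 e2 = - (1 / 2).
Hypothesis e13 : lorentz e1 e3 = -1.
Hypothesis e23 : lorentz e2 e3 = -1.
Implicit Types (g h : 'M[R]_3) (q r : quat).

Let s1 := reflection e1.
Let s2 := reflection e2.
Let s3 := reflection e3.

(** The matrix whose columns are e1, e2, e3. *)
Definition frame : 'M[R]_3 := \matrix_(i, j) (nth 0 [:: e1; e2; e3] j) i 0.
Local Notation P := frame.

Lemma mul_frame g : g *m P = \matrix_(i, j) (g *m nth 0 [:: e1; e2; e3] j) i 0.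
Proof.
apply/matrixP => i j; rewrite !mxE; apply: eq_bigr => k _.
by rewrite !mxE.
Qed.

(** The Gram matrix of e1, e2, e3 has determinant -3/2. *)
Lemma frame_unit : P \in unitmx.
Proof.
have E i j : (P^T *m lorentz_mx R *m P) i j =
    lorentz (nth 0 [:: e1; e2; e3] i) (nth 0 [:: e1; e2; e3] j).
  by rewrite /lorentz_mx mul_mx_diag mxE sum3 lorentzE !mxE !ord_max3 /=; ring.
have : \det (P^T *m lorentz_mx R *m P) = - (3 / 2).
  rewrite det3 !E /= (lorentzC e2 e1) (lorentzC e3 e1) (lorentzC e3 e2).
  by rewrite e11 e22 e33 e12 e13 e23; field.
rewrite !det_mulmx det_tr unitmxE unitfE => dP.
apply/eqP => P0; move: dP; rewrite P0 mulr0 => /eqP; rewrite eq_sym oppr_eq0.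
by rewrite mulf_eq0 invr_eq0 !pnatr_eq0.
Qed.

(** Column j of S lists the coordinates of the image of ej. *)
Lemma reflection_frame (S : 'M[int]_3) (n : 'cV[R]_3) :
  (forall j : 'I_3, nth 0 [:: e1; e2; e3] j
     - (2 * lorentz n (nth 0 [:: e1; e2; e3] j) / lorentz n n) *: n =
     (S 0 j)%:~R *: e1 + (S 1 j)%:~R *: e2 + (S 2 j)%:~R *: e3) ->
  reflection n *m P = P *m map_mx intr S.
Proof.
move=> nS; rewrite mul_frame; apply/matrixP => i j.
rewrite [LHS]mxE reflection_mulmx nS [RHS]mxE sum3 !mxE /=; ring.
Qed.

Definition s1_mx : 'M[int]_3 := mx3 [:: [:: -1; 1; 2]; [:: 0; 1; 0]; [:: 0; 0; 1]].
Definition s2_mx : 'M[int]_3 := mx3 [:: [:: 1; 0; 0]; [:: 1; -1; 2]; [:: 0; 0; 1]].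
Definition s3_mx : 'M[int]_3 := mx3 [:: [:: 1; 0; 0]; [:: 0; 1; 0]; [:: 1; 1; -1]].

Lemma s1_frame : s1 *m P = P *m map_mx intr s1_mx.
Proof.
apply: reflection_frame => j; apply/matrixP => i k; rewrite ord1 e11.
by elim/ord3_ind: j; rewrite /= ?e11 ?e12 ?e13 !mxE /=; field.
Qed.

Lemma s2_frame : s2 *m P = P *m map_mx intr s2_mx.
Proof.
apply: reflection_frame => j; apply/matrixP => i k; rewrite ord1 e22.
by elim/ord3_ind: j; rewrite /= ?(lorentzC e2 e1) ?e22 ?e12 ?e23 !mxE /=; field.
Qed.

Lemma s3_frame : s3 *m P = P *m map_mx intr s3_mx.
Proof.
apply: reflection_frame => j; apply/matrixP => i k; rewrite ord1 e33.
by elim/ord3_ind: j; rewrite /= ?(lorentzC e3) ?e13 ?e23 ?e33 !mxE /=; field.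
Qed.

(** Multiplied by the norm of q to stay free of denominators: g is
    x |-> q x q~ / N(q). *)
Definition acts_as q g : Prop :=
  (qnorm q)%:~R *: (g *m P) = P *m map_mx intr (qrot q).

Lemma acts_as_mul q r g h : acts_as q g -> acts_as r h -> acts_as (qmul q r) (g * h).
Proof.
rewrite /acts_as => qg rh.
rewrite qnormM intrM -scalerA -[g * h *m P]mulmxA scalemxAr rh mulmxA scalemxAl qg -mulmxA.
by rewrite qrotM map_mxM.
Qed.

Lemma acts_as_double q g : acts_as (qdouble q) g -> acts_as q g.
Proof.
rewrite /acts_as qnorm_double qrot_double intrM -scalerA map_mxZ -scalemxAr.
by move/scalerI; apply.
Qed.

Definition spin_group : set 'M[R]_3 := [set g | exists2 q, admissible q & acts_as q g].

Lemma spin_group_mul g h : spin_group g -> spin_group h -> spin_group (g * h).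
Proof.
move=> [q aq qg] [r ar rh]; have := acts_as_mul qg rh.
have [s as_ [->|->]] := admissible_mul aq ar; first by exists s.
by move/acts_as_double; exists s.
Qed.

Lemma spin_group_of q g (M : 'M[int]_3) : admissible q ->
  g *m P = P *m map_mx intr M -> qnorm q *: M = qrot q -> spin_group g.
Proof.
by move=> aq gM qM; exists q => //; rewrite /acts_as -qM map_mxZ -scalemxAr gM.
Qed.

Lemma spin_group1 : spin_group 1.
Proof.
apply: (@spin_group_of (Quat 1 0 0 0) _ 1%:M); first by left.
  by rewrite map_mx1 mulmx1 mul1mx.
by apply/matrixP => i j; elim/ord3_ind: i; elim/ord3_ind: j; rewrite !mxE.
Qed.

Lemma mul_frame2 g h (M N : 'M[int]_3) : g *m P = P *m map_mx intr M ->
  h *m P = P *m map_mx intr N -> g * h *m P = P *m map_mx intr (M *m N).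
Proof. by move=> gM hN; rewrite -[g * h]/(g *m h) -mulmxA hN mulmxA gM -mulmxA map_mxM. Qed.

Ltac mx3_compute :=
  apply: matrix3P; split; split; do ?(rewrite !mxE ?sum3 /=); ring.

(** The product of the reflections in ei and ej is the action of ei ej; the
    quaternions below are e1 e2, e2 e1 = -1 - e1 e2, e1 e3 and
    e3 e1 = -2 - e1 e3. *)
Lemma spin_group_s12 : spin_group (s1 * s2).
Proof.
apply: (spin_group_of (q := Quat 0 1 0 0) _ (mul_frame2 s1_frame s2_frame)); first by left.
mx3_compute.
Qed.

Lemma spin_group_s21 : spin_group (s2 * s1).
Proof.
apply: (spin_group_of (q := Quat (-1) (-1) 0 0) _ (mul_frame2 s2_frame s1_frame)); first by left.
mx3_compute.
Qed.

Lemma spin_group_s13 : spin_group (s1 * s3).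
Proof.
apply: (spin_group_of (q := Quat 0 0 1 0) _ (mul_frame2 s1_frame s3_frame)).
  by right; split=> //; exists 0, 0.
mx3_compute.
Qed.

Lemma spin_group_s31 : spin_group (s3 * s1).
Proof.
apply: (spin_group_of (q := Quat (-2) 0 (-1) 0) _ (mul_frame2 s3_frame s1_frame)).
  by right; split=> //; exists (-1), 0.
mx3_compute.
Qed.

Let W := smallest (@is_subgroup R) [set s2; s3; s1].
Let Gamma : set 'M[R]_3 := [set g | W g /\ \det g = 1].

Let e1_neq0 : lorentz e1 e1 != 0. Proof. by rewrite e11 oner_eq0. Qed.
Let e2_neq0 : lorentz e2 e2 != 0. Proof. by rewrite e22 oner_eq0. Qed.
Let e3_neq0 : lorentz e3 e3 != 0. Proof. by rewrite e33 pnatr_eq0. Qed.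

Let s1K : s1 * s1 = 1. Proof. exact: reflectionK. Qed.
Let s2K : s2 * s2 = 1. Proof. exact: reflectionK. Qed.
Let s3K : s3 * s3 = 1. Proof. exact: reflectionK. Qed.

Lemma W_ind (Q : 'M[R]_3 -> Prop) : Q 1 ->
  (forall g, Q g -> Q (s1 * g)) -> (forall g, Q g -> Q (s2 * g)) ->
  (forall g, Q g -> Q (s3 * g)) -> forall g, W g -> Q g.
Proof.
move=> Q1 Qs1 Qs2 Qs3; apply: involution_group_ind => //.
  by move=> s [[]|] ->.
by move=> s g [[]|] ->; [apply: Qs2 | apply: Qs3 | apply: Qs1].
Qed.

Let mulM g h (x : 'cV[R]_3) : (g * h) *m x = g *m (h *m x).
Proof. by rewrite mulmxA. Qed.

Lemma Gamma_isometry g : Gamma g -> orientation_isometry g.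
Proof.
move=> [Wg dg]; split=> //.
- apply: isometryP; elim/W_ind: g / Wg {dg} => [x y|g IH x y|g IH x y|g IH x y].
  + by rewrite !mul1mx.
  1-3: by rewrite !mulM reflection_isometry.
- elim/W_ind: g / Wg {dg} => [x hx|g IH x hx|g IH x hx|g IH x hx].
  + by rewrite mul1mx.
  1-3: by rewrite !mulM; apply: reflection_hyp_plane (IH _ hx); rewrite ?e11 ?e22 ?e33.
Qed.

(** The products s1 si and si s1 lie in the spin group, so multiplication by any
    of the three reflections exchanges the spin group and its coset by s1; the
    determinant tells the two apart. *)
Lemma Gamma_spin g : Gamma g -> spin_group g.
Proof.
move=> [Wg dg].
suff [[_ //]|[]] : (\det g = 1 /\ spin_group g) \/ (\det g = -1 /\ spin_group (s1 * g)).
  by rewrite dg; lra.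
elim/W_ind: g / Wg {dg} => [|g IH|g IH|g IH].
- by left; rewrite det1; split => //; apply: spin_group1.
- have ds : \det (s1 * g) = - \det g by rewrite det_mulmx det_reflection // mulN1r.
  rewrite ds mulrA s1K mul1r; case: IH => -[-> Kg]; [right|left]; rewrite ?opprK; split => //.
- have ds : \det (s2 * g) = - \det g by rewrite det_mulmx det_reflection // mulN1r.
  rewrite ds; case: IH => -[-> Kg]; [right|left]; rewrite ?opprK; split => //.
    by rewrite mulrA; apply: spin_group_mul Kg; apply: spin_group_s12.
  rewrite -[g]mul1r -s1K -mulrA mulrA; apply: spin_group_mul Kg; exact: spin_group_s21.
- have ds : \det (s3 * g) = - \det g by rewrite det_mulmx det_reflection // mulN1r.
  rewrite ds; case: IH => -[-> Kg]; [right|left]; rewrite ?opprK; split => //.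
    by rewrite mulrA; apply: spin_group_mul Kg; apply: spin_group_s13.
  rewrite -[g]mul1r -s1K -mulrA mulrA; apply: spin_group_mul Kg; exact: spin_group_s31.
Qed.

Lemma mxtrace_frame g (M : 'M[R]_3) : g *m P = P *m M -> \tr g = \tr M.
Proof.
move=> gM; have -> : g = P *m M *m invmx P by rewrite -gM mulmxK // frame_unit.
by rewrite mxtrace_mulC mulmxA mulVmx ?frame_unit // mul1mx.
Qed.

(** For q of norm 2 with a = 2 x and b = 2 y, the trace of q is twice
    2 x - y - c - d. *)
Lemma spin_group_trace g : spin_group g ->
  exists n : int, \tr g = (n ^+ 2 - 1)%:~R \/ \tr g = (2 * n ^+ 2 - 1)%:~R.
Proof.
move=> [q aq]; rewrite /acts_as scalemxAl => /mxtrace_frame.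
rewrite mxtraceZ -[\tr (map_mx _ _)]/(\tr (map_mx (intr : {rmorphism int -> R}) _)).
rewrite trace_map_mx mxtrace_qrot.
case: aq => [->|[-> [x [y [ax yb]]]]] trg.
  by exists (qtrace q); left; rewrite -trg mul1r.
exists (2 * x - y - qc q - qd q); right.
apply: (@mulfI _ 2); first by rewrite pnatr_eq0.
rewrite trg -[2 in RHS]/(2%:~R) -intrM; congr intr.
by case: q ax yb {trg} => a b c d /= -> ->; ring.
Qed.

Lemma Gamma_trace g : Gamma g -> 3 < \tr g -> \tr g = 7 \/ 8 <= \tr g.
Proof.
move=> /Gamma_spin /spin_group_trace [n [->|->]]; rewrite -[3]/(3%:~R) ltr_int => n3.
  right; rewrite -[8]/(8%:~R) ler_int.
  have : 2 < `|n| by nia.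
  nia.
have n2 : 2 <= `|n| by nia.
have sqn : n ^+ 2 = `|n| ^+ 2 by rewrite real_normK ?num_real.
have : (2 * n ^+ 2 - 1 = 7) \/ (8 <= 2 * n ^+ 2 - 1).
  have [nE|?] : `|n| = 2 \/ 3 <= `|n| by lia.
    by left; rewrite sqn nE.
  by right; nia.
by case=> [->|?]; [left | right; rewrite -[8]/(8%:~R) ler_int].
Qed.

(** Named after their traces; gamma7_inv is the inverse of gamma7, the same word
    read backwards. *)
Definition gamma7 := s1 * s2 * (s1 * s3).
Definition gamma7_inv := s3 * s1 * (s2 * s1).
Definition gamma8 := s1 * s3 * (s2 * s3).

Let W1 : W s1. Proof. by apply: sub_gen_smallest; right. Qed.
Let W2 : W s2. Proof. by apply: sub_gen_smallest; left; left. Qed.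
Let W3 : W s3. Proof. by apply: sub_gen_smallest; left; right. Qed.
Let WM g h : W g -> W h -> W (g * h).
Proof.
move=> Wg Wh K KS; have [[_ KM _] _] := KS.
by apply: KM; [exact: Wg | exact: Wh].
Qed.

Let detM4 (a b c d : 'M[R]_3) : \det a = -1 -> \det b = -1 -> \det c = -1 ->
  \det d = -1 -> \det (a * b * (c * d)) = 1.
Proof. by move=> da db dc dd; rewrite !det_mulmx da db dc dd !mulrNN !mulr1. Qed.

Lemma gamma7_in : Gamma gamma7.
Proof. by split; [do 3 ?apply: WM | apply: detM4; exact: det_reflection]. Qed.

Lemma gamma7_inv_in : Gamma gamma7_inv.
Proof. by split; [do 3 ?apply: WM | apply: detM4; exact: det_reflection]. Qed.

Lemma gamma8_in : Gamma gamma8.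
Proof. by split; [do 3 ?apply: WM | apply: detM4; exact: det_reflection]. Qed.

Definition gamma7_mx : 'M[int]_3 := mx3 [:: [:: 4; 3; -4]; [:: 3; 4; -4]; [:: 1; 1; -1]].
Definition gamma7_inv_mx : 'M[int]_3 := mx3 [:: [:: 0; -1; 4]; [:: -1; 0; 4]; [:: -1; -1; 7]].
Definition gamma8_mx : 'M[int]_3 := mx3 [:: [:: 8; 1; -4]; [:: 3; 1; -2]; [:: 3; 0; -1]].

Lemma gamma7_frame : gamma7 *m P = P *m map_mx intr gamma7_mx.
Proof.
rewrite (mul_frame2 (mul_frame2 s1_frame s2_frame) (mul_frame2 s1_frame s3_frame)).
congr (_ *m map_mx _ _); mx3_compute.
Qed.

Lemma gamma7_inv_frame : gamma7_inv *m P = P *m map_mx intr gamma7_inv_mx.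
Proof.
rewrite (mul_frame2 (mul_frame2 s3_frame s1_frame) (mul_frame2 s2_frame s1_frame)).
congr (_ *m map_mx _ _); mx3_compute.
Qed.

Lemma gamma8_frame : gamma8 *m P = P *m map_mx intr gamma8_mx.
Proof.
rewrite (mul_frame2 (mul_frame2 s1_frame s3_frame) (mul_frame2 s2_frame s3_frame)).
congr (_ *m map_mx _ _); mx3_compute.
Qed.

Lemma gamma7_trace : \tr gamma7 = 7.
Proof. by rewrite (mxtrace_frame gamma7_frame) mxtrace3 !mxE /=; ring. Qed.

Lemma gamma7_inv_trace : \tr gamma7_inv = 7.
Proof. by rewrite (mxtrace_frame gamma7_inv_frame) mxtrace3 !mxE /=; ring. Qed.

Lemma gamma8_trace : \tr gamma8 = 8.
Proof. by rewrite (mxtrace_frame gamma8_frame) mxtrace3 !mxE /=; ring. Qed.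

(** Let h act as r = (a, b, c, d).  Modulo 3 the order maps onto the field
    F_3[u] with u^2 = u + 1 and nine elements, r going to (a + b) + (c + d) u,
    and h acts on the lattice modulo 3 and modulo its radical as multiplication
    by r^2, up to the norm.  There gamma7 acts as an element of order 4, so that
    h gamma7 = gamma7^-1 h forces r^2 = 0, hence 3 divides a + b, c + d and the
    norm of r, which is 1 or 2. *)
Lemma gamma7_not_conj h : spin_group h -> h * gamma7 <> gamma7_inv * h.
Proof.
move=> [q aq]; rewrite /acts_as => qh hgg.
have : qrot q *m gamma7_mx = gamma7_inv_mx *m qrot q.
  have E : map_mx intr (qrot q *m gamma7_mx) = map_mx (intr : int -> R) (gamma7_inv_mx *m qrot q).
    apply: (can_inj (mulKmx frame_unit)).
    transitivity ((qnorm q)%:~R *: (h *m gamma7 *m P)).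
      by rewrite map_mxM mulmxA -qh -scalemxAl -(mulmxA h P) -gamma7_frame (mulmxA h).
    rewrite [h *m gamma7]hgg map_mxM mulmxA -gamma7_inv_frame -(mulmxA gamma7_inv P) -qh.
    by rewrite -scalemxAr (mulmxA gamma7_inv).
  apply/matrixP => i j; apply: (@intr_inj R).
  by have /matrixP/(_ i j) := E; rewrite [LHS]mxE [RHS]mxE.
case: q aq {qh} => a b c d.
rewrite /admissible /= => aq /matrixP eM.
have := eM 0 0; have := eM 1 0.
rewrite !(mxE, sum3) /=; move=> eq1 eq0.
have [i [k [aE i3]]] : exists i k, a = 3 * k + i - b /\ 0 <= i <= 2.
  exists ((a + b) %% 3)%Z, ((a + b) %/ 3)%Z; lia.
have [j [l [cE j3]]] : exists j l, c = 3 * l + j - d /\ 0 <= j <= 2.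
  exists ((c + d) %% 3)%Z, ((c + d) %/ 3)%Z; lia.
(* The constant coefficient of r^2 is (a + b)^2 + (c + d)^2; modulo 3 it is
   a multiple of the difference of the two sides of the relation, summed over
   the first two entries of the first column. *)
have [B K] : exists B, (a + b) ^+ 2 + (c + d) ^+ 2 = 3 * B.
  exists ((a + b) ^+ 2 + (c + d) ^+ 2 + 2 * (a * a) - 6 * (a * b) - 4 * (a * c)
    - 12 * (a * d) + b * b + 4 * (b * c) + 8 * (b * d) + 4 * (c * c) + 12 * (c * d) + 8 * (d * d)).
  lia.
have [i0 j0] : i = 0 /\ j = 0.
  have K' : i * i + j * j = 3 * (B - 3 * (k * k) - 2 * (k * i) - 3 * (l * l) - 2 * (l * j)).
    have abE : a + b = 3 * k + i by lia.
    have cdE : c + d = 3 * l + j by lia.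
    by rewrite abE cdE in K; lia.
  move: K'; set B' := _ - _ => K'; clearbody B'.
  have jP : j = 0 \/ j = 1 \/ j = 2 by lia.
  have iP : i = 0 \/ i = 1 \/ i = 2 by lia.
  clear -K' iP jP.
  by case: iP => [iE|[iE|iE]]; case: jP => [jE|[jE|jE]]; subst i j; lia.
have {aE cE} [aE cE] : a = 3 * k - b /\ c = 3 * l - d by lia.
clear -aq aE cE; subst a c; lia.
Qed.

End Triangle344.

(** * The bottom of the length spectrum *)

Lemma two_le_card (T : Type) (B : set T) (x y : T) : B x -> B y -> x <> y -> (`I_2 #<= B)%card.
Proof.
move=> Bx By xy; pose f (i : nat) := if i == 0 then x else y.
have inj : {in `I_2 &, injective f}.
  move=> i j /set_mem /= i2 /set_mem /= j2; rewrite /f.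
  by case: i i2 => [|[|//]] _; case: j j2 => [|[|//]] _ //= e; case: xy.
have /card_eqPle[_ le2] := inj_card_eq inj.
apply: card_le_trans le2 _; apply: subset_card_le => _ [i _ <-].
by rewrite /f; case: ifP.
Qed.

Lemma length_spectrumP (R : realType) (G : set 'M[R]_3) l : length_spectrum G l <->
  exists g, [/\ G g, hyperbolic g & translation_length g = l].
Proof. by split=> [[_ [g gP _]]|[g gP]]; [exists g | exists (conj_class G g), g]. Qed.

Section Spectrum344.
Variables (R : realType) (e1 e2 e3 : 'cV[R]_3).
Hypothesis e11 : lorentz e1 e1 = 1.
Hypothesis e22 : lorentz e2 e2 = 1.
Hypothesis e33 : lorentz e3 e3 = 2.
Hypothesis e12 : lorentz e1 e2 = - (1 / 2).
Hypothesis e13 : lorentz e1 e3 = -1.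
Hypothesis e23 : lorentz e2 e3 = -1.

Let Gamma : set 'M[R]_3 :=
  [set g | smallest (@is_subgroup R) [set reflection e2; reflection e3; reflection e1] g
           /\ \det g = 1].

Lemma Gamma_spectrum l : length_spectrum Gamma l ->
  l = arccosh 3 \/ arccosh (7 / 2) <= l.
Proof.
move=> /length_spectrumP[g [Gg hg <-]].
have og : orientation_isometry g by exact: (Gamma_isometry e11 e22 e33 Gg).
have [t3 ->] := hyperbolic_trace og hg.
have [->|t8] := Gamma_trace e11 e22 e33 e12 e13 e23 Gg t3.
  by left; congr arccosh; field.
by right; rewrite le_arccosh; lra.
Qed.

Lemma Gamma_length g t : Gamma g -> \tr g = t -> 3 < t ->
  hyperbolic g /\ translation_length g = arccosh ((t - 1) / 2).
Proof.
move=> Gg <-; apply: trace_hyperbolic; exact: (Gamma_isometry e11 e22 e33 Gg).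
Qed.

Lemma gamma7P : [/\ Gamma (gamma7 e1 e2 e3), hyperbolic (gamma7 e1 e2 e3) &
  translation_length (gamma7 e1 e2 e3) = arccosh 3].
Proof.
have G7 := gamma7_in e11 e22 e33.
have [] := Gamma_length G7 (gamma7_trace e11 e22 e33 e12 e13 e23); first by lra.
by rewrite (_ : (7 - 1) / 2 = 3); last by field.
Qed.

Lemma gamma7_invP : [/\ Gamma (gamma7_inv e1 e2 e3), hyperbolic (gamma7_inv e1 e2 e3) &
  translation_length (gamma7_inv e1 e2 e3) = arccosh 3].
Proof.
have G7 := gamma7_inv_in e11 e22 e33.
have [] := Gamma_length G7 (gamma7_inv_trace e11 e22 e33 e12 e13 e23); first by lra.
by rewrite (_ : (7 - 1) / 2 = 3); last by field.
Qed.

Lemma spectrum_l1 : length_spectrum Gamma (arccosh 3).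
Proof. by apply/length_spectrumP; exists (gamma7 e1 e2 e3); exact: gamma7P. Qed.

Lemma spectrum_l3 : length_spectrum Gamma (arccosh (7 / 2)).
Proof.
have G8 := gamma8_in e11 e22 e33.
have [] := Gamma_length G8 (gamma8_trace e11 e22 e33 e12 e13 e23); first by lra.
rewrite (_ : (8 - 1) / 2 = 7 / 2); last by field.
by move=> h8 l8; apply/length_spectrumP; exists (gamma8 e1 e2 e3).
Qed.

Lemma multiplicity_l1 : multiplicity_ge Gamma (arccosh 3) 2.
Proof.
apply: (@two_le_card _ _ (conj_class Gamma (gamma7 e1 e2 e3))
  (conj_class Gamma (gamma7_inv e1 e2 e3))).
- by exists (gamma7 e1 e2 e3) => //; exact: gamma7P.
- by exists (gamma7_inv e1 e2 e3) => //; exact: gamma7_invP.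
have G1 : Gamma 1 by split; [move=> K [[]] | rewrite det1].
have : conj_class Gamma (gamma7_inv e1 e2 e3) (gamma7_inv e1 e2 e3).
  by exists 1; rewrite // mul1r invr1 mulr1.
move=> + e; rewrite -e => -[h Gh hE].
have uh : h \is a GRing.unit by rewrite -[_ \is a _]/(h \in unitmx) unitmxE Gh.2 unitr1.
apply: (gamma7_not_conj e11 e22 e33 e12 e13 e23 (h := h)).
  exact: (Gamma_spin e11 e22 e33 e12 e13 e23 Gh).
by rewrite -hE mulrVK.
Qed.

End Spectrum344.

Theorem mainTheorem2 (R : realType) (A B C : 'cV[R]_3)
    (hT : hyp_triangle A B C)
    (hA : hyp_angle A B C = pi / 3)
    (hB : hyp_angle B C A = pi / 4)
    (hC : hyp_angle C A B = pi / 4) :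
  let Gamma := triangle_group A B C in
  let l1 : R := 2 * arccosh (2 * cos (pi / 4) * cos (pi / 3) + cos (pi / 4)) in
  let l3 : R := 2 * arccosh (2 * cos (pi / 4) ^+ 2 + cos (pi / 3)) in
  [/\ length_spectrum Gamma l1,
      (forall l : R, length_spectrum Gamma l -> l1 <= l) &
      multiplicity_ge Gamma l1 2] /\
  [/\ l1 < l3,
      length_spectrum Gamma l3 &
      forall l : R, length_spectrum Gamma l -> ~ (l1 < l < l3)].
Proof.
move=> Gamma l1 l3.
have [e1 [e2 [e3 [[s1 s2 s3] [[e11 e22 e33] [e12 e13 e23]]]]]] := triangle_normals hT hA hB hC.
have c2 := cos_pi4_sq R; have c0 := cos_pi4_gt0 R.
have l1E : l1 = arccosh 3.
  rewrite /l1 cos_pi3 (_ : 2 * _ * _ + _ = 2 * cos (pi / 4)); last by field.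
  rewrite arccosh_double; last by nra.
  by congr arccosh; rewrite exprMn c2; field.
have l3E : l3 = arccosh (7 / 2).
  rewrite /l3 cos_pi3 c2 arccosh_double; last by lra.
  by congr arccosh; field.
have l13 : arccosh 3 < arccosh (7 / 2) :> R by rewrite lt_arccosh; lra.
have -> : Gamma = [set g | smallest (@is_subgroup R)
    [set reflection e2; reflection e3; reflection e1] g /\ \det g = 1].
  by rewrite /Gamma /triangle_group /reflection_group s1 s2 s3.
have spec := Gamma_spectrum e11 e22 e33 e12 e13 e23.
rewrite l1E l3E; split; split.
- exact: spectrum_l1.
- by move=> l /spec[->|] //; apply: le_trans; exact: ltW.
- exact: multiplicity_l1.
- exact: l13.
- exact: spectrum_l3.
- by move=> l /spec[->|l3l] /andP[]; rewrite ?ltxx // => _; rewrite ltNge l3l.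
Qed.
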